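(* Let $\mathcal{A}_{CC}$ be an algorithm that, for an input graph $G=(V,E)$ with $n$ vertices, runs in $T$ rounds of the congested clique model using a local memory of $O(n)$ in each node. One can simulate $\mathcal{A}_{CC}$ in $O(T)$ rounds of the semi-MPC model using $n$ machines.
   Context: Space is measured in words of $O(\log n)$ bits. Congested clique model: the input is a graph $G=(V,E)$ with $n=|V|$. Each node (vertex) of the graph is a computing unit that is initially aware of its incident edges. In synchronous communication rounds, every pair of nodes, even if not connected in the input graph, can exchange a message of size $O(\log n)$ bits. MPC (massively parallel computation) model: an input of size $\ell$ is initially distributed among $p$ machines, each with a space of size $s$. The total space $p\cdot s$ of all machines is bounded by $\widetilde{O}(\ell^{1+\delta})$ for a small parameter $\delta\in[0,1)$ of the algorithm that controls replication (where $\widetilde{O}$ hides polylogarithmic factors). Furthermore, the number of machines should not be more than the space per machine, i.e. $p\le s$. Computation proceeds in synchronous rounds: in each round, each machine performs a local computation on its data and, at the end of the round, communicates with other machines. The total size of the messages that a machine sends or receives in each round should not be more than its space $s$. Semi-MPC model: the input is a graph $G=(V,E)$ with $n=|V|$ and $m=|E|$, whose edges are initially distributed adversarially among the machines. An algorithm is in semi-MPC if it is in MPC and each machine uses a space of size $s=O(n)$ words. Simulating an algorithm means running an algorithm in the target model that, on each input graph, produces the output of the original algorithm; rounds of the simulation are counted in the target model.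
   Formalization: The total space of the machines is compared with the largest input size over all graphs on n vertices, since n machines with p ≤ s need n² words even on sparse graphs; and the number of rounds is O(max(1,T)), since for T = 0 the adversarially distributed edges still need one round. *)

(* Defs.v *)
From HB Require Import structures.
From mathcomp Require Import all_boot all_order all_algebra.
From mathcomp Require Import reals exp.
Set Implicit Arguments.
Unset Strict Implicit.
Unset Printing Implicit Defensive.
Import Order.TTheory GRing.Theory Num.Theory.

Local Open Scope nat_scope.

Record sgraph (n : nat) := SGraph {
  edges : {set {set 'I_n}};
  edgesP : [forall e in edges, #|e| == 2] }.

HB.instance Definition _ n := [isSub for @edges n].
HB.instance Definition _ n := [Finite of sgraph n by <:].

Definition bigO (f g : nat -> nat) : Prop :=
  exists C : nat, forall n, f n <= C * g n.

(* Number of bits of a word, Theta(log n); it is at least 1, also for n <= 1,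
   and every k <= n is written with that many bits. *)
Definition word_bits (n : nat) : nat := (trunc_log 2 n).+1.

(* Synchronous computation on [p] processors, for graphs on [n] vertices.
   The data of a processor at the beginning of a round consist of the bits
   it has kept and of the messages received in the previous round, indexed by
   their senders (the empty string is the absence of a message).  In round [t],
   [step t i] maps the data of processor [i] to the bits it keeps and to its
   outgoing messages, indexed by their recipients.  Local computation is
   unrestricted, and every processor knows [n], [p], its name and the round. *)
Record data (p : nat) := Data {
  memory : seq bool;
  inbox : {ffun 'I_p -> seq bool} }.

Record protocol (n p : nat) (O : Type) := Protocol {
  start : 'I_p -> {set {set 'I_n}} -> seq bool;
  step : nat -> 'I_p -> data p -> seq bool * {ffun 'I_p -> seq bool};
  result : 'I_p -> data p -> O }.

Definition algorithm (p : nat -> nat) (O : Type) :=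
  forall n : nat, protocol n (p n) O.

Section Execution.
Variables (n p : nat) (O : Type) (A : protocol n p O).
Variable (input : 'I_p -> {set {set 'I_n}}).

Fixpoint run (t : nat) : 'I_p -> data p :=
  if t is t'.+1 then
    let r i := step A t' i (run t' i) in
    fun i => Data (r i).1 [ffun j => (r j).2 i]
  else fun i => Data (start A i (input i)) [ffun=> [::]].

Definition output (t : nat) (i : 'I_p) : O := result A i (run t i).

(* Bits received, resp. sent, by processor [i] in the [t]-th communication,
   the one that leads to [run t]; nothing has been exchanged for [t = 0]. *)
Definition received (t : nat) (i : 'I_p) : nat :=
  \sum_(j < p) size (inbox (run t i) j).

Definition sent (t : nat) (i : 'I_p) : nat :=
  \sum_(j < p) size (inbox (run t j) i).

End Execution.

Definition incident n (G : sgraph n) (v : 'I_n) : {set {set 'I_n}} :=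
  [set e in edges G | v \in e].

(* Node [v] of the input graph is processor [v]. *)
Definition congested_clique (O : Type) (A : algorithm (fun n => n) O)
    (T : nat -> nat) : Prop :=
  exists c : nat, forall n (G : sgraph n) (t : nat) (u v : 'I_n),
    t <= T n ->
    size (inbox (run (A n) (incident G) t u) v) <= c * word_bits n.

Definition local_memory_On (O : Type) (A : algorithm (fun n => n) O)
    (T : nat -> nat) : Prop :=
  exists c : nat, forall n (G : sgraph n) (t : nat) (v : 'I_n),
    t <= T n ->
    size (memory (run (A n) (incident G) t v)) <= c * n * word_bits n.

(* Sizes in words: an edge is given by the names of its two endpoints. *)
Definition edges_size n (E : {set {set 'I_n}}) : nat := 2 * #|E|.

Definition input_size n (G : sgraph n) : nat := n + edges_size (edges G).

Definition max_input_size (n : nat) : nat := \max_(G : sgraph n) input_size G.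

(* The machine [d e] initially holds the edge [e]. *)
Definition share n p (G : sgraph n) (d : {set 'I_n} -> 'I_p) (i : 'I_p) :
    {set {set 'I_n}} :=
  [set e in edges G | d e == i].

Definition fits n p (G : sgraph n) (s : nat) (d : {set 'I_n} -> 'I_p) : Prop :=
  forall i : 'I_p, edges_size (share G d i) <= s.

(* [p n] machines with [s n] words each, during [rounds n] rounds.  The space
   is fixed by the number [n] of vertices alone, so that the total space is
   compared with the size of the largest input on [n] vertices. *)
Record mpc (R : realType) (delta : R) (O : Type) (p s : nat -> nat)
    (A : algorithm p O) (rounds : nat -> nat) : Prop := MPC {
  mpc_total_space : exists (K : R) (k : nat), forall n,
    let l := max_input_size n in
    ((p n * s n)%:R <=
       K * (word_bits l)%:R ^+ k * l%:R `^ (1 + delta))%R;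
  mpc_machines : forall n, p n <= s n;
  mpc_space : forall n (G : sgraph n) (d : {set 'I_n} -> 'I_(p n)),
    fits G (s n) d ->
    forall (t : nat) (i : 'I_(p n)), t <= rounds n ->
    size (memory (run (A n) (share G d) t i))
      + received (A n) (share G d) t i <= s n * word_bits n;
  mpc_communication : forall n (G : sgraph n) (d : {set 'I_n} -> 'I_(p n)),
    fits G (s n) d ->
    forall (t : nat) (i : 'I_(p n)), t <= rounds n ->
    sent (A n) (share G d) t i <= s n * word_bits n
    /\ received (A n) (share G d) t i <= s n * word_bits n }.

Definition semi_mpc (R : realType) (delta : R) (O : Type) (p s : nat -> nat)
    (A : algorithm p O) (rounds : nat -> nat) : Prop :=
  mpc delta s A rounds /\ bigO s (fun n => n).

(* For every graph and every initial distribution of its edges, machine [v]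
   of [B] ends with the output of node [v] of [A]. *)
Definition simulates (O : Type) (s : nat -> nat)
    (B : algorithm (fun n => n) O) (rounds : nat -> nat)
    (A : algorithm (fun n => n) O) (T : nat -> nat) : Prop :=
  forall n (G : sgraph n) (d : {set 'I_n} -> 'I_n), fits G (s n) d ->
  forall v : 'I_n,
    output (B n) (share G d) (rounds n) v = output (A n) (incident G) (T n) v.

(* Main.v *)
Require Import Defs.
From mathcomp Require Import all_boot all_order all_algebra.
From mathcomp Require Import reals exp.
Set Implicit Arguments.
Unset Strict Implicit.
Unset Printing Implicit Defensive.
Import Order.TTheory GRing.Theory Num.Theory.

Local Open Scope nat_scope.

(** Machine [v] plays node [v].  In the first round every machine tells both
endpoints of each of its edges the name of the other endpoint: with names of
exactly [word_bits n] bits, a machine holding [k] edges sends [2 * k] words,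
that is, what the edges occupied initially, and node [v] receives at most [n]
words since every edge has only one holder.  From then on each machine knows
the neighbourhood of its node and follows the given algorithm step by step.  In
a round of the latter a node receives one message of O(1) words from each of
the [n] nodes, so O(n) words per machine suffice.  The complete graph gives
[n ^ 2 <= max_input_size n], which accounts for the total space. *)

(** * Fixed-length codes for sets of vertices and of edges *)

Definition encode (X : finType) (f : X -> seq bool) (S : {set X}) : seq bool :=
  flatten [seq f x | x <- enum S].

(** The number of blocks is recovered from the length of the string, so codes need neither
    separators nor a header. *)
Definition decode (X : finType) (f : X -> seq bool) (D : {set X}) (L : nat)
    (m : seq bool) : {set X} :=
  [set x in D | f x \in reshape (nseq (size m %/ L) L) m].

Lemma shape_encode (X : finType) (f : X -> seq bool) (S : {set X}) (L : nat) :
  {in S, forall x, size (f x) = L} ->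
  shape [seq f x | x <- enum S] = nseq #|S| L.
Proof.
move=> fL; rewrite cardE /shape -map_comp.
have: {in enum S, forall x, size (f x) = L} by move=> x; rewrite mem_enum => /fL.
elim: (enum S) => //= x s IHs sL.
rewrite sL ?mem_head // IHs // => y ys.
by apply: sL; rewrite inE ys orbT.
Qed.

Lemma size_encode (X : finType) (f : X -> seq bool) (S : {set X}) (L : nat) :
  {in S, forall x, size (f x) = L} -> size (encode f S) = L * #|S|.
Proof. by move=> fL; rewrite size_flatten (shape_encode fL) sumn_nseq. Qed.

Lemma encodeK (X : finType) (f : X -> seq bool) (D S : {set X}) (L : nat) :
  0 < L -> {in D &, injective f} -> {in D, forall x, size (f x) = L} ->
  S \subset D -> decode f D L (encode f S) = S.
Proof.
move=> L0 f_inj fL /subsetP SD.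
have fLS : {in S, forall x, size (f x) = L} by move=> x /SD; exact: fL.
rewrite /decode (size_encode fLS) mulKn // -(shape_encode fLS) flattenK.
apply/setP=> x; rewrite inE; apply/andP/idP => [[xD /mapP[y]] | xS].
  by rewrite mem_enum => yS /f_inj ->//; exact: SD.
by rewrite SD // map_f // mem_enum.
Qed.

Lemma leq_card_words (n : nat) : n <= #|{: (word_bits n).-tuple bool}|.
Proof. by rewrite card_tuple card_bool ltnW // trunc_log_ltn. Qed.

Definition word (n : nat) (i : 'I_n) : seq bool :=
  enum_val (widen_ord (leq_card_words n) i).

Lemma size_word (n : nat) (i : 'I_n) : size (word i) = word_bits n.
Proof. exact: size_tuple. Qed.

Lemma word_inj (n : nat) : injective (@word n).
Proof. move=> i j ij; apply/ord_inj.
by have /(congr1 (@nat_of_ord _)) := enum_val_inj (val_inj ij). Qed.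

Definition encode_nodes (n : nat) : {set 'I_n} -> seq bool := encode (@word n).

Definition decode_nodes (n : nat) (m : seq bool) : {set 'I_n} :=
  decode (@word n) setT (word_bits n) m.

Lemma size_encode_nodes (n : nat) (S : {set 'I_n}) :
  size (encode_nodes S) = word_bits n * #|S|.
Proof. by apply: size_encode => i _; exact: size_word. Qed.

Lemma encode_nodesK (n : nat) : cancel (@encode_nodes n) (@decode_nodes n).
Proof.
move=> S; apply: encodeK; rewrite ?subsetT //.
  by move=> i j _ _ /word_inj.
by move=> i _; exact: size_word.
Qed.

Definition pairs (n : nat) : {set {set 'I_n}} :=
  [set e : {set 'I_n} | #|e| == 2].

Definition encode_edges (n : nat) : {set {set 'I_n}} -> seq bool :=
  encode (@encode_nodes n).

(** The domain is [pairs n] because the length of [encode_nodes e] varies with the cardinality of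
    [e], while blocks must have equal length. *)
Definition decode_edges (n : nat) (m : seq bool) : {set {set 'I_n}} :=
  decode (@encode_nodes n) (pairs n) (word_bits n * 2) m.

Lemma size_encode_pair (n : nat) :
  {in pairs n, forall e, size (encode_nodes e) = word_bits n * 2}.
Proof. by move=> e; rewrite inE size_encode_nodes => /eqP->. Qed.

Lemma size_encode_edges (n : nat) (E : {set {set 'I_n}}) :
  E \subset pairs n -> size (encode_edges E) = edges_size E * word_bits n.
Proof.
move=> /subsetP EP; rewrite /edges_size mulnC mulnA; apply: size_encode => e eE.
by rewrite size_encode_pair ?EP.
Qed.

Lemma encode_edgesK (n : nat) (E : {set {set 'I_n}}) :
  E \subset pairs n -> decode_edges n (encode_edges E) = E.
Proof.
apply: encodeK; first by rewrite muln_gt0.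
  by move=> d e _ _; exact: (can_inj (@encode_nodesK n)).
exact: size_encode_pair.
Qed.

(** * Neighbourhoods and the volume of the first exchange *)

Definition neighbours (n : nat) (E : {set {set 'I_n}}) (v : 'I_n) : {set 'I_n} :=
  [set u | [set u; v] \in E].

Lemma set2_injl (T : finType) (v : T) : injective (fun u => [set u; v]).
Proof.
move=> u w uw; have: u \in [set w; v] by rewrite -uw set21.
case/set2P=> // uv; have: w \in [set u; v] by rewrite uw set21.
by rewrite uv => /set2P[] ->.
Qed.

(** Double counting: [u] maps injectively to the edge [[set u; v]] of [E] through [v], and every
    edge has two endpoints. This bounds what a machine sends. *)
Lemma sum_neighbours (n : nat) (E : {set {set 'I_n}}) :
  E \subset pairs n -> \sum_v #|neighbours E v| <= edges_size E.
Proof.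
move=> /subsetP EP.
apply: (@leq_trans (\sum_v \sum_(e in E) (v \in e))).
  apply: leq_sum => v _.
  rewrite -(card_imset _ (@set2_injl _ v)) -big_mkcondr /= sum1_card.
  apply/subset_leq_card/subsetP=> e /imsetP[u]; rewrite inE => uvE ->.
  by rewrite unfold_in uvE set22.
rewrite exchange_big /edges_size mulnC -sum_nat_const.
apply: leq_sum => e /EP; rewrite inE => /eqP <-.
by rewrite -big_mkcond sum1_card.
Qed.

Lemma edges_sub_pairs (n : nat) (G : sgraph n) : edges G \subset pairs n.
Proof.
apply/subsetP=> e eG; rewrite inE.
by have /forall_inP/(_ e eG) := edgesP G.
Qed.

Lemma share_sub_pairs (n p : nat) (G : sgraph n) (d : {set 'I_n} -> 'I_p)
    (i : 'I_p) : share G d i \subset pairs n.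
Proof.
by apply: subset_trans (edges_sub_pairs G); apply/subsetP=> e /setIdP[].
Qed.

Lemma neighbours_share (n p : nat) (G : sgraph n) (d : {set 'I_n} -> 'I_p)
    (v : 'I_n) :
  \bigcup_i neighbours (share G d i) v = neighbours (edges G) v.
Proof.
apply/setP=> u; rewrite inE; apply/bigcupP/idP => [[i _]|uvG].
  by rewrite !inE => /andP[].
by exists (d [set u; v]); rewrite // !inE uvG eqxx.
Qed.

(** Each [u] is counted for at most one machine, [d [set u; v]]. This bounds what a machine
    receives. *)
Lemma sum_neighbours_share (n p : nat) (G : sgraph n) (d : {set 'I_n} -> 'I_p)
    (v : 'I_n) :
  \sum_i #|neighbours (share G d i) v| <= n.
Proof.
apply: (@leq_trans (\sum_(i < p) \sum_(u < n) (d [set u; v] == i))).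
  apply: leq_sum => i _; rewrite -big_mkcond sum1_card.
  by apply/subset_leq_card/subsetP=> u; rewrite !inE => /andP[].
rewrite exchange_big -[leqRHS]card_ord -sum1_card.
by apply: leq_sum => u _; rewrite -big_mkcond (big_pred1 (d [set u; v])).
Qed.

Lemma incidentE (n : nat) (G : sgraph n) (v : 'I_n) :
  [set [set u; v] | u in neighbours (edges G) v] = incident G v.
Proof.
apply/setP=> e; apply/imsetP/setIdP => [[u]|[eG ve]].
  by rewrite inE => uvG ->; rewrite set22.
have := subsetP (edges_sub_pairs G) e eG; rewrite inE => /cards2P[x [y [_ eE]]].
move: ve eG; rewrite eE => /set2P[] ->; last by exists x; rewrite // inE.
by rewrite setUC; exists y; rewrite // inE.
Qed.

(** * The simulating protocol and its correctness *)

Definition node_start (n : nat) (O : Type) (A : protocol n n O) (v : 'I_n)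
    (x : data n) : data n :=
  Data (start A v [set [set u; v] | u in \bigcup_j decode_nodes n (inbox x j)])
       [ffun=> [::]].

(* Round [0] distributes the edges; at the beginning of round [1] the inbox
   contains names of neighbours, so that [node_start] has to set up the initial
   data of [A].  If [T = 0], there is no round [1] and [result] does it. *)
Definition simulation (n : nat) (O : Type) (A : protocol n n O) (T : nat) :
    protocol n n O :=
  Protocol
    (fun _ E => encode_edges E)
    (fun t v x =>
       match t with
       | 0 => ([::], [ffun w => encode_nodes
                                  (neighbours (decode_edges n (memory x)) w)])
       | 1 => step A 0 v (node_start A v x)
       | t'.+1 => step A t' v x
       end)
    (fun v x => result A v (if T == 0 then node_start A v x else x)).

Lemma simulation_inbox1 (n : nat) (O : Type) (A : protocol n n O) (T : nat)
    (G : sgraph n) (d : {set 'I_n} -> 'I_n) (v i : 'I_n) :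
  inbox (run (simulation A T) (share G d) 1 v) i =
  encode_nodes (neighbours (share G d i) v).
Proof. by rewrite /= !ffunE encode_edgesK // share_sub_pairs. Qed.

Lemma simulation_node_start (n : nat) (O : Type) (A : protocol n n O) (T : nat)
    (G : sgraph n) (d : {set 'I_n} -> 'I_n) (v : 'I_n) :
  node_start A v (run (simulation A T) (share G d) 1 v) =
  run A (incident G) 0 v.
Proof.
rewrite [RHS]/= -incidentE -(neighbours_share G d) /node_start.
by under eq_bigr do rewrite simulation_inbox1 encode_nodesK.
Qed.

(** The next data depend only on what [step] returns on all processors. The round numbers [k] and
    [l] may differ because the simulation lags one round behind. *)
Lemma eq_runS (n n' p : nat) (O O' : Type) (P : protocol n p O)
    (Q : protocol n' p O') (f : 'I_p -> {set {set 'I_n}})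
    (g : 'I_p -> {set {set 'I_n'}}) (k l : nat) :
  (forall i, step P k i (run P f k i) = step Q l i (run Q g l i)) ->
  forall i, run P f k.+1 i = run Q g l.+1 i.
Proof.
by move=> PQ i /=; rewrite PQ; congr Data; apply/ffunP=> j; rewrite !ffunE PQ.
Qed.

(** At time 1 the inboxes hold neighbour names rather than data of [A], so the runs are compared
    from time 2 on. *)
Lemma run_simulation (n : nat) (O : Type) (A : protocol n n O) (T : nat)
    (G : sgraph n) (d : {set 'I_n} -> 'I_n) (t : nat) (v : 'I_n) :
  run (simulation A T) (share G d) t.+2 v = run A (incident G) t.+1 v.
Proof.
elim: t v => [|t IHt]; apply: eq_runS => v.
  by rewrite -(simulation_node_start A T G d).
by rewrite -IHt.
Qed.

Lemma output_simulation (n : nat) (O : Type) (A : protocol n n O) (T : nat)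
    (G : sgraph n) (d : {set 'I_n} -> 'I_n) (v : 'I_n) :
  output (simulation A T) (share G d) T.+1 v = output A (incident G) T v.
Proof.
case: T => [|T]; rewrite /output.
  by rewrite -(simulation_node_start A 0 G d).
by rewrite run_simulation.
Qed.

(** In [s], the inbox of [A] accounts for [a * n] words and its memory for [b * n]; the extra [n]
    gives [n <= s] for the first exchange. *)
Lemma simulation_space (n : nat) (O : Type) (A : protocol n n O)
    (T a b : nat) (G : sgraph n) (d : {set 'I_n} -> 'I_n) :
  let s := (a + b).+1 * n in
  (forall t u v, t <= T ->
     size (inbox (run A (incident G) t u) v) <= a * word_bits n) ->
  (forall t v, t <= T ->
     size (memory (run A (incident G) t v)) <= b * n * word_bits n) ->
  fits G s d -> forall t v, t <= T.+1 ->
  let B := simulation A T in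
  size (memory (run B (share G d) t v)) + received B (share G d) t v
    <= s * word_bits n
  /\ sent B (share G d) t v <= s * word_bits n.
Proof.
move=> s Hin Hmem dG t v tT B.
have n_le_s : n <= s by rewrite leq_pmull.
(* Time 0: the initial edges. Time 1: the neighbour names. Later: the data of [A] one round
   earlier. *)
case: t tT => [_|[_|t tT]].
- rewrite /received /sent !big1 ?addn0 => [|i _|i _]; rewrite ?ffunE //.
  by rewrite [size _]size_encode_edges ?share_sub_pairs // leq_mul2r dG orbT.
- split.
    rewrite add0n /received.
    under eq_bigr do rewrite simulation_inbox1 size_encode_nodes.
    rewrite -big_distrr /= mulnC leq_mul2r; apply/orP; right.
    exact: leq_trans (sum_neighbours_share G d v) n_le_s.
  rewrite /sent.
  under eq_bigr do rewrite simulation_inbox1 size_encode_nodes.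
  rewrite -big_distrr /= mulnC leq_mul2r; apply/orP; right.
  exact: leq_trans (sum_neighbours (share_sub_pairs G d v)) (dG v).
have sumE (F : 'I_n -> nat) : (forall j, F j <= a * word_bits n) ->
    \sum_j F j <= a * n * word_bits n.
  move=> Fa; apply: (@leq_trans (\sum_(j < n) a * word_bits n)).
    exact: leq_sum.
  by rewrite sum_nat_const card_ord mulnA [n * a]mulnC.
split.
  rewrite run_simulation /s mulSn mulnDl mulnDl mulnDl addnA.
  apply: (@leq_trans (b * n * word_bits n + a * n * word_bits n)); last first.
    by rewrite addnC -addnA leq_addl.
  apply: leq_add; first exact: Hmem.
  by apply: sumE => j; rewrite run_simulation Hin.
apply: (@leq_trans (a * n * word_bits n)).
  by apply: sumE => j; rewrite run_simulation Hin.
by rewrite leq_mul2r leq_mul2r ltnW ?orbT // ltnS leq_addr.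
Qed.

(** For the complete graph, the [n] vertices and the [n * (n - 1)] endpoints of edges add up to
    [n * n]. *)
Lemma sqr_le_max_input_size (n : nat) : n * n <= max_input_size n.
Proof.
have Pn : [forall e in pairs n, #|e| == 2].
  by apply/forall_inP=> e; rewrite inE.
apply: leq_trans (leq_bigmax (SGraph Pn)).
rewrite /input_size /edges_size /= card_draws card_ord.
by rewrite mul_bin_left bin1; case: n {Pn} => // n; rewrite subn1 mulSn.
Qed.

(* [maxn 1 (T n)]: bringing the edges from an arbitrary initial distribution to
   the nodes they are incident to already takes a round when [T n = 0]. *)
Theorem theorem3p1 (R : realType) (delta : R)
    (hdelta : (0 <= delta < 1)%R)
    (O : Type) (A : algorithm (fun n => n) O) (T : nat -> nat)
    (hA : congested_clique A T) (hmem : local_memory_On A T) :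
  exists (s rounds : nat -> nat) (B : algorithm (fun n => n) O),
    [/\ semi_mpc delta s B rounds,
        bigO rounds (fun n => maxn 1 (T n))
      & simulates s B rounds A T].
Proof.
have [a Ha] := hA; have [b Hb] := hmem.
exists (fun n => (a + b).+1 * n), (fun n => (T n).+1).
exists (fun n => simulation (A n) (T n)).
have space n (G : sgraph n) d := @simulation_space n O (A n) (T n) a b G d
  (Ha n G) (Hb n G).
split.
- split; last by exists (a + b).+1.
  split=> [|n|n G d dG t i tT|n G d dG t i tT].
  (* The total space is a constant times [n * n], so the logarithmic factor gets exponent 0. *)
  + exists (a + b).+1%:R%R, 0 => n /=; set l := max_input_size n.
    rewrite GRing.expr0 GRing.mulr1 mulnCA natrM ler_wpM2l ?ler0n //.
    apply: (@le_trans _ _ l%:R%R); first by rewrite ler_nat sqr_le_max_input_size.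
    (* Monotonicity of powers in the exponent requires a base of at least 1, so [l = 0] is treated
       apart. *)
    case: (posnP l) => [->|l_gt0]; first exact: powR_ge0.
    rewrite -[leLHS]powRr1 ?ler0n // ler_powR ?ler1n //.
    by case/andP: hdelta => d0 _; rewrite lerDl.
  + exact: leq_pmull.
  + by case: (space _ _ _ dG t i tT).
  + have [recv_le sent_le] := space _ _ _ dG t i tT.
    by split=> //; apply: leq_trans recv_le; exact: leq_addl.
- exists 2 => n; rewrite mul2n -addnn -add1n.
  by rewrite leq_add ?leq_maxl ?leq_maxr.
- by move=> n G d _ v; exact: output_simulation.
Qed.
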